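(* Let $N\ge 2$ be an integer and let $S$ be either $A_N=A/\mathcal I_N A$ or $\widetilde A_N=A/\widetilde{\mathcal I}_N A$. Let $V_S=\langle v_0,\dots,v_{N-1}\rangle_S\subseteq \hat V\otimes_A S$ be the $S$-submodule spanned by the first $N$ basis vectors of the Verma module. Then for every $n\ge 1$ the generic braid group action $\hat\rho_n$, specialised to $S$, preserves the submodule $V_S^{\otimes n}\subseteq(\hat V\otimes_A S)^{\otimes n}$ and hence induces a braid group representation $$B_n\longrightarrow \operatorname{Aut}_S\bigl(V_S^{\otimes n}\bigr).$$ (For $S=A_N$ this representation is denoted $\rho_{N,n}$ and $V_S=V_N$; for $S=\widetilde A_N$ it is denoted $\widetilde\rho_{N,n}$ and $V_S=\widetilde V_N$.)
   Context: Let $L=\mathbb Q[q^{\pm2},s^{\pm2}]\subset A=\mathbb Q[q^{\pm1},s^{\pm1}]$. Let $\varphi_d$ be the $d$-th cyclotomic polynomial. Define ideals of $L$: $$\mathcal I_N=\bigl(\varphi_N(q^2)(s^2q^{-2(N-1)}-1)\bigr),\qquad \widetilde{\mathcal I}_N=\mathcal I_N\cap\prod_{d\mid N,\ d\ne 1,N}\Bigl(\varphi_d(q^2),\ \tfrac{s^{2d}-1}{s^2-1}\Bigr)$$ (an empty product of ideals is $L$). $[m]_q=\frac{q^m-q^{-m}}{q-q^{-1}}$, $[m]_q!=[1]_q\cdots[m]_q$, ${m\brack j}_q=\frac{[m]_q!}{[m-j]_q!\,[j]_q!}$. $\hat V$ is the (Verma) free $A$-module with basis $v_0,v_1,v_2,\dots$.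 On $\hat V\otimes\hat V$ one has the mutually inverse operators $$R(v_i\otimes v_j)= s^{-(i+j)} \sum_{n=0}^{i} q^{2(i-n)(j+n)}q^{\frac{n(n-1)}{2}} {n+j \brack j}_q \prod_{k=0}^{n-1}(sq^{-k-j}-s^{-1}q^{k+j}) \ v_{j+n}\otimes v_{i-n},$$ $$R^{-1}(v_i\otimes v_j)= s^{i+j} \sum_{n=0}^{j} (-1)^{n}q^{-2ij}q^{-\frac{n(n-1)}{2}} {n+i \brack i}_q \prod_{k=0}^{n-1}(sq^{-i-k}-s^{-1}q^{k+i}) \ v_{j-n}\otimes v_{i+n}.$$ The generic braid group action $\hat\rho_n:B_n\to\operatorname{Aut}(\hat V^{\otimes n})$ is the representation with $\hat\rho_n(\sigma_i^{\pm1})=\mathrm{Id}^{\otimes(i-1)}\otimes R^{\pm1}\otimes\mathrm{Id}^{\otimes(n-i-1)}$. *)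

(* Defs.v *)
From HB Require Import structures.
From mathcomp Require Import all_boot all_order all_algebra all_field.
From mathcomp Require Import ring_quotient fraction generic_quotient.
From mathcomp Require Import finmap boolp classical_sets.
From mathcomp Require Import monalg ring.

Set Implicit Arguments.
Unset Strict Implicit.
Unset Printing Implicit Defensive.

Import GRing.Theory.
Local Open Scope classical_set_scope.
Local Open Scope ring_scope.

(* The rational function field Q(q, s), with q the inner and s the outer
   polynomial variable. *)
Definition ratfun : fieldType := {fraction {poly {poly rat}}}.
Definition constF (c : rat) : ratfun := tofrac c%:P%:P.
Definition qF : ratfun := tofrac ('X%:P).
Definition sF : ratfun := tofrac 'X.

Lemma qF_neq0 : qF != 0.
Proof. by rewrite tofrac_eq0 polyC_eq0 polyX_eq0. Qed.

Lemma sF_neq0 : sF != 0.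
Proof. by rewrite tofrac_eq0 polyX_eq0. Qed.

(* laurent e is the subring Q[q^{+-e}, s^{+-e}] of Q(q, s): the finite sums of
   terms c q^{ea} s^{eb}, encoded as ((c, a), b) with a, b in Z. *)
Definition laurent_term (e : nat) (u : rat * int * int) : ratfun :=
  constF u.1.1 * (qF ^+ e) ^ u.1.2 * (sF ^+ e) ^ u.2.

Definition laurent (e : nat) : {pred ratfun} := fun x =>
  `[< exists t : seq (rat * int * int), x = \sum_(u <- t) laurent_term e u >].

Lemma laurentP e x :
  reflect (exists t, x = \sum_(u <- t) laurent_term e u) (x \in laurent e).
Proof. exact: asboolP. Qed.

Lemma mulr3ACA (R : comNzRingType) (x y a b c d : R) :
  x * y * (a * b) * (c * d) = x * a * c * (y * b * d).
Proof. by rewrite -(mulrACA (x * a)) -(mulrACA x). Qed.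

Lemma laurent_termM e u v :
  laurent_term e (u.1.1 * v.1.1, u.1.2 + v.1.2, u.2 + v.2) =
  laurent_term e u * laurent_term e v.
Proof.
rewrite /laurent_term /=.
rewrite expfzDr; last exact: (expf_neq0 _ qF_neq0).
rewrite expfzDr; last exact: (expf_neq0 _ sF_neq0).
by rewrite /constF polyCM polyCM tofracM; exact: mulr3ACA.
Qed.

Lemma laurent_monomial e c (a b : int) :
  constF c * (qF ^+ e) ^ a * (sF ^+ e) ^ b \in laurent e.
Proof. by apply/laurentP; exists [:: (c, a, b)]; rewrite big_seq1. Qed.

Lemma laurent_subring e : subring_closed (laurent e).
Proof.
split.
- have := laurent_monomial e 1 0 0.
  by rewrite !expr0z !mulr1 /constF !polyC1 tofrac1.
- move=> _ _ /laurentP[t ->] /laurentP[t' ->]; apply/laurentP.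
  exists (t ++ [seq (- u.1.1, u.1.2, u.2) | u <- t']).
  rewrite big_cat big_map -sumrN; congr (_ + _); apply: eq_bigr => u _.
  by rewrite /laurent_term /constF !polyCN tofracN !mulNr.
- move=> _ _ /laurentP[t ->] /laurentP[t' ->]; apply/laurentP.
  exists [seq (u.1.1 * v.1.1, u.1.2 + v.1.2, u.2 + v.2) | u <- t, v <- t'].
  rewrite mulr_suml big_allpairs_dep; apply: eq_bigr => u _.
  by rewrite mulr_sumr; apply: eq_bigr => v _; rewrite laurent_termM.
Qed.

HB.instance Definition _ e :=
  GRing.isSubringClosed.Build ratfun (laurent e) (laurent_subring e).

Record laurent_poly (e : nat) : predArgType :=
  LaurentPoly { laurent_val :> ratfun; _ : laurent_val \in laurent e }.

HB.instance Definition _ e := [isSub for @laurent_val e].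
HB.instance Definition _ e := [Choice of laurent_poly e by <:].
HB.instance Definition _ e :=
  [SubChoice_isSubComNzRing of laurent_poly e by <:].

Notation ringA := (laurent_poly 1).
Notation ringL := (laurent_poly 2).

Lemma laurent_val_in e (x : laurent_poly e) : laurent_val x \in laurent e.
Proof. exact: valP. Qed.

Lemma laurent_val_sum e (I : Type) (t : seq I) (F : I -> laurent_poly e) :
  laurent_val (\sum_(i <- t) F i) = \sum_(i <- t) laurent_val (F i).
Proof. exact: (raddf_sum (val : laurent_poly e -> ratfun)). Qed.

Lemma laurent_qz e (z : int) : (qF ^+ e) ^ z \in laurent e.
Proof.
by have := laurent_monomial e 1 z 0;
  rewrite expr0z mulr1 /constF !polyC1 tofrac1 mul1r.
Qed.

Lemma laurent_sz e (z : int) : (sF ^+ e) ^ z \in laurent e.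
Proof.
by have := laurent_monomial e 1 0 z;
  rewrite expr0z /constF !polyC1 tofrac1 !mul1r.
Qed.

Lemma laurentW x : x \in laurent 2 -> x \in laurent 1.
Proof.
move=> /laurentP[t ->]; apply: rpred_sum => -[[c a] b] _.
rewrite /laurent_term /= !exprnP !exprz_exp.
by have := laurent_monomial 1 c (2%:Z * a) (2%:Z * b); rewrite !expr1.
Qed.

Definition LtoA (x : ringL) : ringA := LaurentPoly (laurentW (laurent_val_in x)).

Definition ideal_span (T : comNzRingType) (X : set T) : set T :=
  [set x | exists t : seq (T * T),
     (forall u, u \in t -> X u.2) /\ x = \sum_(u <- t) u.1 * u.2].

Definition ideal_mul (T : comNzRingType) (I J : set T) : set T :=
  ideal_span [set z | exists2 x, I x & exists2 y, J y & z = x * y].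

Definition phi_q2F (d : nat) : ratfun :=
  (map_poly (fun z : int => z%:~R) 'Phi_d).[qF ^+ 2].

Lemma phi_q2_laurent d : phi_q2F d \in laurent 2.
Proof.
rewrite /phi_q2F horner_coef; apply: rpred_sum => i _.
rewrite coef_map_id0 // rpredM ?rpred_int // rpredX //.
exact: (laurent_qz 2 1).
Qed.

Definition phi_q2 (d : nat) : ringL := LaurentPoly (phi_q2_laurent d).

Definition s_quotF (d : nat) : ratfun := (sF ^+ (2 * d) - 1) / (sF ^+ 2 - 1).

Lemma sF2_neq1 : sF ^+ 2 - 1 != 0.
Proof.
rewrite subr_eq0 -tofracXn -tofrac1 tofrac_eq; apply/eqP.
by move=> /(congr1 (fun p : {poly {poly rat}} => size p));
  rewrite size_polyXn size_poly1.
Qed.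

Lemma s_quot_laurent d : s_quotF d \in laurent 2.
Proof.
rewrite /s_quotF exprM subrX1 mulrC mulKf ?sF2_neq1 //.
by apply: rpred_sum => i _; apply: rpredX; exact: (laurent_sz 2 1).
Qed.

Definition s_quot (d : nat) : ringL := LaurentPoly (s_quot_laurent d).

Definition I_genF (N : nat) : ratfun :=
  phi_q2F N * (sF ^+ 2 * qF ^ (- (2 * (N%:Z - 1))) - 1).

Lemma I_gen_laurent N : I_genF N \in laurent 2.
Proof.
rewrite rpredM ?phi_q2_laurent // rpredB ?rpred1 // rpredM //.
  exact: (laurent_sz 2 1).
rewrite -mulrN -exprz_exp; exact: laurent_qz.
Qed.

Definition I_gen (N : nat) : ringL := LaurentPoly (I_gen_laurent N).

Definition ideal_I (N : nat) : set ringL := ideal_span [set I_gen N].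

Definition ideal_J (d : nat) : set ringL := ideal_span [set phi_q2 d; s_quot d].

Definition ideal_Itilde (N : nat) : set ringL :=
  ideal_I N `&`
  \big[@ideal_mul ringL / setT]_(d <- divisors N | (d != 1%N) && (d != N))
    ideal_J d.

Variant variant := Plain | Tilde.

Definition ideal_of (v : variant) (N : nat) : set ringL :=
  match v with Plain => ideal_I N | Tilde => ideal_Itilde N end.

Definition extended_ideal (I : set ringL) : set ringA := ideal_span (LtoA @` I).

Definition quot_ideal (v : variant) (N : nat) : {pred ringA} :=
  fun x => `[< extended_ideal (ideal_of v N) x >].

Lemma ideal_span0 (T : comNzRingType) (X : set T) : ideal_span X 0.
Proof. by exists [::]; split=> //; rewrite big_nil. Qed.

Lemma ideal_spanDM (T : comNzRingType) (X : set T) a x y :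
  ideal_span X x -> ideal_span X y -> ideal_span X (a * x + y).
Proof.
move=> [t [tX ->]] [t' [t'X ->]].
exists ([seq (a * u.1, u.2) | u <- t] ++ t'); split.
  by move=> u; rewrite mem_cat => /orP[/mapP[w /tX Xw ->]|/t'X].
rewrite big_cat big_map mulr_sumr; congr (_ + _).
by apply: eq_bigr => u _; rewrite mulrA.
Qed.

(* x is regular at q = s = 1, with value c there. *)
Definition at1 (c : rat) (x : ratfun) : Prop :=
  exists p d : {poly {poly rat}},
    [/\ x * tofrac d = tofrac p, d.[1].[1] != 0 & p.[1].[1] = c * d.[1].[1]].

Lemma at1_poly (p : {poly {poly rat}}) : at1 p.[1].[1] (tofrac p).
Proof. by exists p, 1; split; rewrite ?tofrac1 ?mulr1 // !hornerC ?mulr1 ?oner_neq0. Qed.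

Lemma at1D c c' x y : at1 c x -> at1 c' y -> at1 (c + c') (x + y).
Proof.
move=> [p [d [e n v]]] [p' [d' [e' n' v']]]; exists (p * d' + p' * d), (d * d').
split; rewrite ?(hornerD, hornerM) ?mulf_neq0 //.
  by rewrite tofracD !tofracM -e -e' mulrDl mulrA; congr (_ + _);
     rewrite [tofrac d * _]mulrC mulrA.
by rewrite v v' mulrDl mulrA; congr (_ + _); rewrite [d.[1].[1] * _]mulrC mulrA.
Qed.

Lemma at1M c c' x y : at1 c x -> at1 c' y -> at1 (c * c') (x * y).
Proof.
move=> [p [d [e n v]]] [p' [d' [e' n' v']]]; exists (p * p'), (d * d').
by split; rewrite ?hornerM ?mulf_neq0 // ?tofracM -?e -?e' ?v ?v' mulrACA.
Qed.

Lemma at1V x : at1 1 x -> at1 1 x^-1.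
Proof.
move=> [p [d [e n v]]]; exists d, p; rewrite v !mul1r; split=> //.
have [x0|x0] := eqVneq x 0; last by rewrite -e mulKf.
move: e; rewrite x0 mul0r => /esym/eqP; rewrite tofrac_eq0 => /eqP p0.
by move: v n; rewrite p0 !horner0 mul1r => <-; rewrite eqxx.
Qed.

Lemma at1_1 : at1 1 1.
Proof. by have := at1_poly 1; rewrite tofrac1 !hornerC. Qed.

Lemma at1_q : at1 1 qF.
Proof. by have := at1_poly ('X%:P); rewrite hornerC hornerX. Qed.

Lemma at1_s : at1 1 sF.
Proof. by have := at1_poly 'X; rewrite hornerX hornerC. Qed.

Lemma at1X x n : at1 1 x -> at1 1 (x ^+ n).
Proof.
move=> hx; elim: n => [|n IH]; first exact: at1_1.
by rewrite exprS -[1]mulr1; apply: at1M.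
Qed.

Lemma at1Xz x (z : int) : at1 1 x -> at1 1 (x ^ z).
Proof. by move=> hx; case: z => n; [exact: at1X | apply/at1V/at1X]. Qed.

Lemma at1_laurent e x : x \in laurent e -> exists c, at1 c x.
Proof.
move=> /laurentP[t ->]; elim: t => [|u t [c IH]].
  by exists 0; rewrite big_nil -tofrac0; have := at1_poly 0; rewrite !horner0.
rewrite big_cons; eexists; apply: at1D IH; apply: at1M; last first.
  exact/at1Xz/at1X/at1_s.
apply: at1M; last exact/at1Xz/at1X/at1_q.
exact: at1_poly.
Qed.

Lemma at1_ideal_I N (x : ringL) : ideal_I N x -> at1 0 (laurent_val x).
Proof.
have g0 : at1 0 (I_genF N).
  have [c hc] := at1_laurent (phi_q2_laurent N).
  rewrite -(mulr0 c); apply: at1M hc _; rewrite -(subrr 1).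
  apply: at1D.
    by rewrite -[1]mulr1; apply: at1M; [exact/at1X/at1_s | exact/at1Xz/at1_q].
  by have := at1_poly (- 1); rewrite tofracN tofrac1 !hornerE.
case=> t [tX ->]; rewrite laurent_val_sum.
elim: t tX => [|u t IH] tX.
  by rewrite big_nil -tofrac0; have := at1_poly 0; rewrite !horner0.
rewrite big_cons -[0]addr0; apply: at1D; last first.
  by apply: IH => w wt; apply: tX; rewrite inE wt orbT.
have [c hc] := at1_laurent (laurent_val_in u.1).
by rewrite -(mulr0 c); apply: at1M hc _; rewrite (tX u) ?mem_head.
Qed.

Lemma quot_ideal_closed v N : idealr_closed (quot_ideal v N).
Proof.
split.
- exact/asboolP/ideal_span0.
- apply/asboolP => -[t [tX /(congr1 (@laurent_val 1))]].
  have {}tX u : u \in t -> at1 0 (laurent_val u.2).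
    move=> /tX[x xI <-]; apply: (@at1_ideal_I N).
    by case: v xI {tX} => //= -[].
  move=> e; suff : at1 0 1.
    case=> p [d [/eqP]]; rewrite mul1r tofrac_eq => /eqP -> n.
    by rewrite mul0r => /eqP; rewrite (negPf n).
  rewrite -[1]/(laurent_val (1 : ringA)) e laurent_val_sum.
  elim: t tX {e} => [|u t IH] tX.
    by rewrite big_nil -tofrac0; have := at1_poly 0; rewrite !horner0.
  rewrite big_cons -[0]addr0; apply: at1D; last first.
    by apply: IH => w wt; apply: tX; rewrite inE wt orbT.
  have [c hc] := at1_laurent (laurent_val_in u.1).
  by rewrite -(mulr0 c); apply: at1M hc _; apply: tX; rewrite mem_head.
- by move=> a x y /asboolP hx /asboolP hy; apply/asboolP/ideal_spanDM.
Qed.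

HB.instance Definition _ v N :=
  isIdealr.Build ringA (quot_ideal v N) (quot_ideal_closed v N).

(* quotS Plain N is A_N and quotS Tilde N is the tilde version. *)
Definition quotS (v : variant) (N : nat) : comNzRingType :=
  {ideal_quot (quot_ideal v N)}.

Definition piS (v : variant) (N : nat) (a : ringA) : quotS v N :=
  (\pi_({ideal_quot (quot_ideal v N)}) a)%qT.

Definition qint (m : nat) : ratfun := (qF ^+ m - qF ^- m) / (qF - qF^-1).
Definition qfact (m : nat) : ratfun := \prod_(1 <= i < m.+1) qint i.
Definition qbinom (m j : nat) : ratfun := qfact m / (qfact (m - j) * qfact j).

Definition R_coefF (i j n : nat) : ratfun :=
  sF ^- (i + j) * (qF ^+ (2 * (i - n) * (j + n)) * qF ^+ (n * n.-1)./2
    * qbinom (n + j) j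
    * \prod_(k < n) (sF * qF ^- (k + j) - sF^-1 * qF ^+ (k + j))).

Definition Rinv_coefF (i j n : nat) : ratfun :=
  sF ^+ (i + j) * ((-1) ^+ n * qF ^- (2 * i * j) * qF ^- (n * n.-1)./2
    * qbinom (n + i) i
    * \prod_(k < n) (sF * qF ^- (i + k) - sF^-1 * qF ^+ (k + i))).

Lemma qint_neq0 m : qint m.+1 != 0.
Proof.
have h n : qF ^+ n.+1 - qF ^- n.+1 != 0.
  rewrite subr_eq0; apply/eqP => /(congr1 ( *%R^~ (qF ^+ n.+1))).
  rewrite mulVf ?expf_neq0 ?qF_neq0 // -exprD -tofracXn -tofrac1 => /eqP.
  rewrite tofrac_eq -polyC_exp -polyC1 (inj_eq (@polyC_inj _)) => /eqP.
  by move/(congr1 (fun p : {poly rat} => size p)); rewrite size_polyXn size_poly1 addSn.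
by rewrite mulf_neq0 // invr_eq0; exact: (h 0%N).
Qed.

Lemma qfact_neq0 m : qfact m != 0.
Proof.
rewrite /qfact big_add1 /= big_mkord.
by apply/prodf_neq0 => i _; exact: qint_neq0.
Qed.

Lemma qfactS m : qfact m.+1 = qfact m * qint m.+1.
Proof. by rewrite /qfact big_nat_recr. Qed.

Lemma qintD a b : qint (a + b) = qF ^+ b * qint a + qF ^- a * qint b.
Proof.
rewrite /qint !mulrA -mulrDl; congr (_ / _).
rewrite !mulrBr [qF ^- a * qF ^+ b]mulrC -invfM -!exprD [(b + a)%N]addnC.
by rewrite addrA subrK.
Qed.

Lemma laurent1_q n : qF ^+ n \in laurent 1.
Proof. by apply: rpredX; have := laurent_qz 1 1; rewrite !expr1z expr1. Qed.

Lemma laurent1_qV n : qF ^- n \in laurent 1.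
Proof. by have := laurent_qz 1 (- n%:Z); rewrite expr1 -exprnN. Qed.

Lemma laurent1_s n : sF ^+ n \in laurent 1.
Proof. by apply: rpredX; have := laurent_sz 1 1; rewrite !expr1z expr1. Qed.

Lemma laurent1_sV n : sF ^- n \in laurent 1.
Proof. by have := laurent_sz 1 (- n%:Z); rewrite expr1 -exprnN. Qed.

Lemma qfact0 : qfact 0 = 1.
Proof. by rewrite /qfact big_geq. Qed.

Lemma qbinom0 m : qbinom m 0 = 1.
Proof. by rewrite /qbinom subn0 qfact0 mulr1 divff ?qfact_neq0. Qed.

Lemma qbinomnn m : qbinom m m = 1.
Proof. by rewrite /qbinom subnn qfact0 mul1r divff ?qfact_neq0. Qed.

Lemma pascal_field (F : fieldType) (x y u w p q z : F) :
  x != 0 -> y != 0 -> u != 0 -> w != 0 ->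
  z * (p * x + q * y) / ((u * x) * (w * y)) =
  p * (z / (u * (w * y))) + q * (z / ((u * x) * w)).
Proof. by move=> x0 y0 u0 w0; field; rewrite x0 y0 u0 w0. Qed.

Lemma qbinomS a b : qbinom (a.+1 + b.+1) b.+1 =
  qF ^+ b.+1 * qbinom (a + b.+1) b.+1 + qF ^- a.+1 * qbinom (a.+1 + b) b.
Proof.
rewrite /qbinom addnK addnK addnK.
have -> : qfact (a.+1 + b.+1) = qfact (a + b.+1) * qint (a.+1 + b.+1).
  by rewrite addSn qfactS.
have -> : (a.+1 + b = a + b.+1)%N by rewrite addSnnS.
rewrite qintD (qfactS a) (qfactS b).
exact: (pascal_field _ _ _ (qint_neq0 a) (qint_neq0 b) (qfact_neq0 a)
  (qfact_neq0 b)).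
Qed.

Lemma qbinom_laurent a b : qbinom (a + b) b \in laurent 1.
Proof.
elim: a b => [|a IHa] b; first by rewrite add0n qbinomnn rpred1.
elim: b => [|b IHb]; first by rewrite qbinom0 rpred1.
rewrite qbinomS; apply: rpredD; apply: rpredM; rewrite ?IHa ?IHb //.
  exact: laurent1_q.
exact: laurent1_qV.
Qed.

Lemma R_factor_laurent a b :
  sF * qF ^- a - sF^-1 * qF ^+ b \in laurent 1.
Proof.
apply: rpredB; apply: rpredM.
- exact: (laurent1_s 1).
- exact: laurent1_qV.
- exact: (laurent1_sV 1).
- exact: laurent1_q.
Qed.

Lemma R_coef_laurent i j n : R_coefF i j n \in laurent 1.
Proof.
apply: rpredM; first exact: laurent1_sV.
apply: rpredM; last by apply: rpred_prod => k _; exact: R_factor_laurent.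
apply: rpredM; last exact: qbinom_laurent.
by apply: rpredM; exact: laurent1_q.
Qed.

Lemma Rinv_coef_laurent i j n : Rinv_coefF i j n \in laurent 1.
Proof.
apply: rpredM; first exact: laurent1_s.
apply: rpredM; last by apply: rpred_prod => k _; exact: R_factor_laurent.
apply: rpredM; last exact: qbinom_laurent.
apply: rpredM; last exact: laurent1_qV.
by apply: rpredM; [rewrite rpredX // rpredN rpred1 | exact: laurent1_qV].
Qed.

Definition R_coef (i j n : nat) : ringA := LaurentPoly (R_coef_laurent i j n).
Definition Rinv_coef (i j n : nat) : ringA := LaurentPoly (Rinv_coef_laurent i j n).

(* {malg S[K]} is the free S-module on K, with basis << k >>, k in K. *)
Definition linext (S : nzRingType) (K K' : choiceType)
    (f : K -> {malg S[K']}) (x : {malg S[K]}) : {malg S[K']} :=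
  \sum_(k <- msupp x) x@_k *: f k.

(* The n-th tensor power of the free S-module on v_0, v_1, ...: it is free on
   the v_{t_1} (x) ... (x) v_{t_n}, t an n-tuple of naturals. *)
Notation verma_pow S n := {malg S[n.-tuple nat]}.

(* The tensor square, with basis v_i (x) v_j indexed by (i, j). *)
Notation verma_sq S := {malg S[(nat * nat)%type]}.

Definition R_op : verma_sq ringA -> verma_sq ringA := linext (fun p =>
  \sum_(n < p.1.+1)
    << R_coef p.1 p.2 n *g ((p.2 + n)%N, (p.1 - n)%N) >>).

Definition Rinv_op : verma_sq ringA -> verma_sq ringA := linext (fun p =>
  \sum_(n < p.2.+1)
    << Rinv_coef p.1 p.2 n *g ((p.2 - n)%N, (p.1 + n)%N) >>).

Definition put (n i : nat) (t : n.-tuple nat) (p : nat * nat) : n.-tuple nat :=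
  [tuple if k == i :> nat then p.1 else if k == i.+1 :> nat then p.2
         else tnth t k | k < n].

(* Id^{(x) i} (x) F (x) Id^{(x) (n-i-2)}, the strands being numbered from 0. *)
Definition on_strands (S : nzRingType) (n i : nat)
    (F : verma_sq S -> verma_sq S) : verma_pow S n -> verma_pow S n :=
  linext (fun t => linext (fun p => << put i t p >>)
    (F << (nth 0%N t i, nth 0%N t i.+1) >>)).

Section Braid.
Variable n : nat.

(* (true, i) stands for sigma_{i+1} and (false, i) for its inverse. *)
Definition braid_word : choiceType := seq (bool * 'I_n.-1).

Inductive braid_eq : braid_word -> braid_word -> Prop :=
| braid_eq_refl w : braid_eq w w
| braid_eq_sym w w' : braid_eq w w' -> braid_eq w' w
| braid_eq_trans w1 w2 w3 : braid_eq w1 w2 -> braid_eq w2 w3 -> braid_eq w1 w3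
| braid_eq_cat w1 w1' w2 w2' :
    braid_eq w1 w1' -> braid_eq w2 w2' -> braid_eq (w1 ++ w2) (w1' ++ w2')
| braid_eq_inv b i : braid_eq [:: (b, i); (~~ b, i)] [::]
| braid_eq_far (i j : 'I_n.-1) : (i.+1 < j)%N ->
    braid_eq [:: (true, i); (true, j)] [:: (true, j); (true, i)]
| braid_eq_braid (i j : 'I_n.-1) : j = i.+1 :> nat ->
    braid_eq [:: (true, i); (true, j); (true, i)]
             [:: (true, j); (true, i); (true, j)].

Definition braid_rel : rel braid_word := fun w w' => `[< braid_eq w w' >].

Lemma braid_rel_equiv : equiv_class_of braid_rel.
Proof.
split=> [w|w w'|w2 w1 w3]; first exact/asboolP/braid_eq_refl.
  by apply/asboolP/asboolP; apply: braid_eq_sym.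
by move=> /asboolP h /asboolP h'; apply/asboolP; exact: braid_eq_trans h h'.
Qed.

Canonical braid_equiv := EquivRelPack braid_rel_equiv.
Canonical braid_encModRel := defaultEncModRel braid_rel.

Definition braid : Type := {eq_quot braid_rel}%qT.
HB.instance Definition _ : EqQuotient braid_word braid_rel braid :=
  EqQuotient.on braid.
HB.instance Definition _ := Choice.on braid.

Definition braid_pi (w : braid_word) : braid := (\pi_braid w)%qT.

Lemma braid_piP w w' : braid_pi w = braid_pi w' <-> braid_eq w w'.
Proof.
split=> [/eqmodP/asboolP //|h]; apply/eqmodP; exact/asboolP.
Qed.

Definition braid_winv (w : braid_word) : braid_word :=
  rev [seq (~~ l.1, l.2) | l <- w].

Definition braid_one : braid := braid_pi [::].
Definition braid_mul (x y : braid) : braid := braid_pi (repr x ++ repr y).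
Definition braid_inv (x : braid) : braid := braid_pi (braid_winv (repr x)).

Lemma braid_reprK x : braid_pi (repr x) = x.
Proof. exact: reprK. Qed.

Lemma braid_eq_repr w : braid_eq (repr (braid_pi w)) w.
Proof. by apply/braid_piP; rewrite braid_reprK. Qed.

Lemma braid_pi_cat w w' : braid_mul (braid_pi w) (braid_pi w') =
  braid_pi (w ++ w').
Proof. by apply/braid_piP; apply: braid_eq_cat; apply: braid_eq_repr. Qed.

Lemma braid_winvK : involutive braid_winv.
Proof.
move=> w; rewrite /braid_winv map_rev revK -map_comp -[RHS]map_id.
by apply: eq_map => -[b i] /=; rewrite negbK.
Qed.

Lemma braid_winvr w : braid_eq (w ++ braid_winv w) [::].
Proof.
elim: w => [|[b i] w IH]; first exact: braid_eq_refl.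
apply: braid_eq_trans (braid_eq_inv b i).
have -> : ((b, i) :: w) ++ braid_winv ((b, i) :: w) =
    [:: (b, i)] ++ ((w ++ braid_winv w) ++ [:: (~~ b, i)]).
  by rewrite /braid_winv /= rev_cons -cats1 catA.
exact: (braid_eq_cat (braid_eq_refl [:: (b, i)])
  (braid_eq_cat IH (braid_eq_refl [:: (~~ b, i)]))).
Qed.

Lemma braid_mulA : associative braid_mul.
Proof.
move=> x y z; rewrite -[x]braid_reprK -[y]braid_reprK -[z]braid_reprK.
by rewrite !braid_pi_cat catA.
Qed.

Lemma braid_mul1 : left_id braid_one braid_mul.
Proof. by move=> x; rewrite -[x]braid_reprK braid_pi_cat. Qed.

Lemma braid_mulr1 : right_id braid_one braid_mul.
Proof. by move=> x; rewrite -[x]braid_reprK braid_pi_cat cats0. Qed.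

Lemma braid_mulV : left_inverse braid_one braid_inv braid_mul.
Proof.
move=> x; rewrite -{2}[x]braid_reprK braid_pi_cat; apply/braid_piP.
by rewrite -{2}[repr x]braid_winvK; exact: braid_winvr.
Qed.

Lemma braid_mulrV : right_inverse braid_one braid_inv braid_mul.
Proof.
move=> x; rewrite -{1}[x]braid_reprK braid_pi_cat; apply/braid_piP.
exact: braid_winvr.
Qed.

HB.instance Definition _ := isGroup.Build braid
  braid_mulA braid_mul1 braid_mulr1 braid_mulV braid_mulrV.

(* sigma i is the standard generator sigma_{i+1} of the braid group B_n. *)
Definition sigma (i : 'I_n.-1) : braid := braid_pi [:: (true, i)].

End Braid.

Section LinearAut.
Variables (S : nzRingType) (M : lmodType S).

Record linaut : Type := LinAut {
  linaut_fun :> M -> M;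
  linaut_inv : M -> M;
  linaut_linear : linear linaut_fun;
  linaut_funK : cancel linaut_fun linaut_inv;
  linaut_invK : cancel linaut_inv linaut_fun }.

Lemma linautP (f g : linaut) : f =1 g -> f = g.
Proof.
case: f g => [f f' lf fK f'K] [g g' lg gK g'K] /= /funext fg.
subst g.
have e : g' = f' by apply/funext => x; rewrite -{1}[x]f'K gK.
by subst g'; congr LinAut; exact: Prop_irrelevance.
Qed.

HB.instance Definition _ := gen_eqMixin linaut.
HB.instance Definition _ := gen_choiceMixin linaut.

HB.instance Definition _ (f : linaut) :=
  GRing.isLinear.Build S M M *:%R (linaut_fun f) (linaut_linear f).

Lemma linaut_one_linear : linear (@id M). Proof. by []. Qed.

Definition linaut_one : linaut :=
  LinAut linaut_one_linear (frefl (@id M)) (frefl (@id M)).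

Lemma linaut_mul_linear (f g : linaut) : linear (f \o g).
Proof. by move=> a x y; rewrite /= !linearP. Qed.

Definition linaut_mul (f g : linaut) : linaut :=
  LinAut (linaut_mul_linear f g)
    (can_comp (linaut_funK f) (linaut_funK g))
    (can_comp (linaut_invK g) (linaut_invK f)).

Lemma linaut_inv_linear (f : linaut) : linear (linaut_inv f).
Proof.
move=> a x y; apply: (can_inj (linaut_funK f)).
by rewrite [RHS]linaut_linear !linaut_invK.
Qed.

Definition linaut_V (f : linaut) : linaut :=
  LinAut (linaut_inv_linear f) (linaut_invK f) (linaut_funK f).

Lemma linaut_mulA : associative linaut_mul.
Proof. by move=> f g h; exact: linautP. Qed.
Lemma linaut_mul1 : left_id linaut_one linaut_mul.
Proof. by move=> f; exact: linautP. Qed.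
Lemma linaut_mulr1 : right_id linaut_one linaut_mul.
Proof. by move=> f; exact: linautP. Qed.
Lemma linaut_mulV : left_inverse linaut_one linaut_V linaut_mul.
Proof. by move=> f; apply: linautP => x; exact: linaut_funK. Qed.
Lemma linaut_mulrV : right_inverse linaut_one linaut_V linaut_mul.
Proof. by move=> f; apply: linautP => x; exact: linaut_invK. Qed.

(* Aut_S(M), with (f * g) x = f (g x). *)
HB.instance Definition _ := isGroup.Build linaut
  linaut_mulA linaut_mul1 linaut_mulr1 linaut_mulV linaut_mulrV.

End LinearAut.

Definition is_generic_braid_action (n : nat)
    (rho : {multiplicative braid n -> linaut (verma_pow ringA n)}) : Prop :=
  forall i : 'I_n.-1,
    rho (sigma i) =1 on_strands i R_op /\
    rho (sigma i)^-1%g =1 on_strands i Rinv_op.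

(* F (x) id_S for an endomorphism F of the free module on K over ringA, read
   on the bases: << k >> is sent to the image of F << k >> under piS applied to
   its coefficients. *)
Definition specialize (v : variant) (N : nat) (K : choiceType)
    (F : {malg ringA[K]} -> {malg ringA[K]}) :
    {malg (quotS v N)[K]} -> {malg (quotS v N)[K]} :=
  linext (fun k => \sum_(l <- msupp (F << k >>))
    << piS v N (F << k >>)@_l *g l >>).

(* The S-span of the v_{t_1} (x) ... (x) v_{t_n} with all t_i < N. *)
Definition truncated (S : nzRingType) (N n : nat) : {pred verma_pow S n} :=
  fun x => `[< exists c : n.-tuple 'I_N -> S,
    x = \sum_(t : n.-tuple 'I_N) c t *: << map_tuple val t >> >].

Lemma truncated_submod (S : nzRingType) (N n : nat) :
  submod_closed (@truncated S N n).
Proof.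
split.
  by apply/asboolP; exists (fun=> 0); rewrite big1 // => t _; rewrite scale0r.
move=> a _ _ /asboolP[c ->] /asboolP[c' ->]; apply/asboolP.
exists (fun t => a * c t + c' t); rewrite scaler_sumr -big_split /=.
by apply: eq_bigr => t _; rewrite scalerDl scalerA.
Qed.

HB.instance Definition _ (S : nzRingType) (N n : nat) :=
  GRing.isSubmodClosed.Build S (verma_pow S n) (@truncated S N n)
    (@truncated_submod S N n).

(* V_S^{(x) n} as an S-module. *)
Record trunc_pow (S : nzRingType) (N n : nat) : predArgType := TruncPow {
  trunc_val :> verma_pow S n; _ : trunc_val \in @truncated S N n }.

HB.instance Definition _ (S : nzRingType) (N n : nat) :=
  [isSub for @trunc_val S N n].
HB.instance Definition _ (S : nzRingType) (N n : nat) :=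
  [Choice of trunc_pow S N n by <:].
HB.instance Definition _ (S : nzRingType) (N n : nat) :=
  [SubChoice_isSubLmodule of trunc_pow S N n by <:].

(* Main.v *)
(* R carries v_i (x) v_j out of the truncation only through terms whose
   coefficient is a unit of A times

     [m + n choose m]_(q^2) * prod_(m <= k < m + n) (s^2 - q^(2k)),

   with m, n < N <= m + n (m = j for R and m = i for its inverse), so it is
   enough that this element lies in the ideal.  The binomial is divisible by
   phi_N(q^2) and the factor k = N - 1 occurs in the product, which gives I_N.
   For a divisor d of N, either n < d and phi_d(q^2) divides the binomial, as
   the multiple N of d lies in (m, m + n]; or d <= n and the product contains
   d consecutive factors, whose product is s^(2d) - 1 modulo phi_d(q^2).
   Distinct phi_d are coprime over Q, so the ideals
   (phi_d(q^2), (s^(2d) - 1)/(s^2 - 1)) are pairwise comaximal and their product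
   contains their intersection.
   Specialisation is functorial on linear maps, hence preservation by the
   generators and their inverses passes to the whole braid group. *)
Require Import Defs.
From HB Require Import structures.
From mathcomp Require Import all_boot all_order all_algebra all_field.
From mathcomp Require Import ring_quotient fraction.
From mathcomp Require Import finmap boolp classical_sets.
From mathcomp Require Import monalg ring zify.

Set Implicit Arguments.
Unset Strict Implicit.
Unset Printing Implicit Defensive.

Import GRing.Theory.
Local Open Scope ring_scope.

(** * Cyclotomic polynomials over the rationals: divisibility and coprimality *)

Definition PhiQ (d : nat) : {poly rat} := map_poly intr 'Phi_d.

Lemma map_ratr_PhiQ d (z : algC) :
  d.-primitive_root z -> map_poly ratr (PhiQ d) = cyclotomic z d.
Proof.
move=> pz; rewrite -(Cintr_Cyclotomic pz) /PhiQ -map_poly_comp.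
by apply: eq_map_poly => a /=; rewrite ratr_int.
Qed.

(** Over [algC] the cyclotomic polynomial splits into distinct linear factors at the primitive d-th
    roots of unity, and divisibility descends to the rationals. *)
Lemma dvdp_PhiQ d (p : {poly rat}) : (0 < d)%N ->
  (forall z : algC, d.-primitive_root z -> root (map_poly ratr p) z) ->
  PhiQ d %| p.
Proof.
move=> d0 hp; have [z pz] := C_prim_root_exists d0.
rewrite -(dvdp_map (@ratr algC)) (map_ratr_PhiQ pz) /cyclotomic.
rewrite -big_filter.
rewrite -(big_map (fun k : 'I_d => z ^+ k) predT (fun w => 'X - w%:P)).
apply: uniq_roots_dvdp.
  apply/allP => _ /mapP[k + ->]; rewrite mem_filter => /andP[ck _].
  by apply: hp; rewrite prim_root_exp_coprime.
rewrite uniq_rootsE map_inj_in_uniq ?filter_uniq ?index_enum_uniq //.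
move=> i j _ _ /eqP; rewrite (eq_prim_root_expr pz) !modn_small // => /eqP.
exact: val_inj.
Qed.

Lemma coprimep_PhiQ d (p : {poly rat}) : (0 < d)%N ->
  (forall z : algC, d.-primitive_root z -> ~~ root (map_poly ratr p) z) ->
  coprimep (PhiQ d) p.
Proof.
move=> d0 hp; have [z pz] := C_prim_root_exists d0.
rewrite -(coprimep_map (@ratr algC)) (map_ratr_PhiQ pz).
apply/Pdiv.ClosedField.coprimepP => w.
by rewrite (root_cyclotomic pz) => /hp.
Qed.

Lemma coprimep_PhiQ_Xn_sub_1 d i : (0 < i < d)%N ->
  coprimep (PhiQ d) ('X^i - 1).
Proof.
case/andP=> i0 id; apply: coprimep_PhiQ; first exact: leq_trans id.
move=> z pz; rewrite rmorphB rmorph1 /= map_polyXn rootE !hornerE subr_eq0.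
by rewrite -(prim_order_dvd pz) gtnNdvd.
Qed.

(** A common root would have exact multiplicative order both d and e. *)
Lemma coprimep_PhiQ_PhiQ d e : (0 < d)%N -> (0 < e)%N -> d != e ->
  coprimep (PhiQ d) (PhiQ e).
Proof.
move=> d0 e0 de; apply: coprimep_PhiQ => // z pz; apply/negP.
have [w pw] := C_prim_root_exists e0.
rewrite (map_ratr_PhiQ pw) (root_cyclotomic pw) => pze.
case/negP: de; rewrite eqn_dvd (prim_order_dvd pz) (prim_order_dvd pze).
by rewrite (prim_expr_order pz) (prim_expr_order pze) eqxx.
Qed.

Lemma dvdp_PhiQ_Xn_sub_1 d n : (0 < d)%N -> (d %| n)%N -> PhiQ d %| 'X^n - 1.
Proof.
move=> d0 dn; apply: dvdp_PhiQ => // z pz.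
rewrite rmorphB rmorph1 /= map_polyXn rootE !hornerE subr_eq0.
by rewrite -(prim_order_dvd pz).
Qed.

(** * Gaussian binomials and products of consecutive linear factors *)

(* The Gaussian binomial coefficient [a + b choose b]. *)
Fixpoint gauss (a b : nat) {struct a} : {poly rat} :=
  match a with
  | 0 => 1
  | a'.+1 => (fix gaussS (b : nat) : {poly rat} := match b with
      | 0 => 1
      | b'.+1 => ('X^b * gauss a' b + gaussS b')%R
      end) b
  end.

Arguments gauss : simpl never.

Lemma gaussSS a b :
  gauss a.+1 b.+1 = 'X^(b.+1) * gauss a b.+1 + gauss a.+1 b.
Proof. by []. Qed.

Lemma gauss0n b : gauss 0 b = 1. Proof. by []. Qed.

Lemma gaussn0 a : gauss a 0 = 1. Proof. by case: a. Qed.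

(** Up to sign, the q-Pochhammer symbol (x; x)_n. *)
Definition qpoch (n : nat) : {poly rat} := \prod_(1 <= i < n.+1) ('X^i - 1).

Lemma qpochS n : qpoch n.+1 = qpoch n * ('X^(n.+1) - 1).
Proof. by rewrite /qpoch big_nat_recr. Qed.

Lemma gauss_qpoch a b : gauss a b * (qpoch a * qpoch b) = qpoch (a + b).
Proof.
have qpoch0 : qpoch 0 = 1 by rewrite /qpoch big_geq.
elim: a b => [|a IHa] b; first by rewrite gauss0n qpoch0 !mul1r.
elim: b => [|b IHb]; first by rewrite gaussn0 qpoch0 mulr1 mul1r addn0.
have := IHa b.+1; rewrite -addSnnS => IHa1.
(* The Pascal rule splits the product in two; the sum closes by x^(b+1) (x^(a+1) - 1) + (x^(b+1) -
   1) = x^(a+b+2) - 1. *)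
transitivity ('X^(b.+1) * ('X^(a.+1) - 1) *
    (gauss a b.+1 * (qpoch a * qpoch b.+1))
  + ('X^(b.+1) - 1) * (gauss a.+1 b * (qpoch a.+1 * qpoch b))).
  by rewrite gaussSS !qpochS; ring.
rewrite IHa1 IHb addnS qpochS -addnS exprD; ring.
Qed.

Lemma qpoch_neq0 n : qpoch n != 0.
Proof.
rewrite prodf_seq_neq0; apply/allP => i; rewrite mem_index_iota => /andP[i0 _].
by rewrite monic_neq0 // monicXnsubC.
Qed.

(** Multiplying by [qpoch a], which is coprime to [PhiQ d] because a < d, turns the binomial into
    the product of the x^i - 1 over b < i <= a + b; the factor i = m is divisible by [PhiQ d]. *)
Lemma PhiQ_dvd_gauss d a b m : (a < d)%N -> (d %| m)%N -> (b < m <= a + b)%N ->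
  PhiQ d %| gauss a b.
Proof.
move=> ad dm /andP[bm mab].
have d0 : (0 < d)%N by exact: leq_ltn_trans ad.
have cop : coprimep (PhiQ d) (qpoch a).
  rewrite /qpoch big_seq; elim/big_ind: _ => [|p r|i].
  - exact: coprimep1.
  - by rewrite coprimepMr => -> ->.
  rewrite mem_index_iota => /andP[i0 ia].
  by apply: coprimep_PhiQ_Xn_sub_1; rewrite i0 (leq_trans ia).
rewrite -(Gauss_dvdpl _ cop) -(dvdp_mul2r _ _ (qpoch_neq0 b)) -mulrA.
rewrite gauss_qpoch mulrC /qpoch.
rewrite [X in _ %| X](@big_cat_nat _ _ _ b.+1) //=; last first.
  by rewrite ltnS leq_addl.
apply: dvdp_mul => //.
rewrite (big_rem m) /=; last by rewrite mem_index_iota bm.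
by apply/dvdp_mulr/dvdp_PhiQ_Xn_sub_1.
Qed.

(* A polynomial in x is divisible by Phi_d(x) as soon as it vanishes at the
   primitive d-th roots of unity, where the factors run through all Y - z^k. *)
Lemma prod_consecutive d m : (0 < d)%N ->
  exists C : {poly {poly rat}},
    \prod_(m <= k < m + d) ('X - ('X^k)%:P) = 'X^d - 1 + (PhiQ d)%:P * C.
Proof.
move=> d0; set P := \prod_(_ <= _ < _) _.
have dvdC i : PhiQ d %| (P - ('X^d - 1))`_i.
  apply: dvdp_PhiQ => // z pz.
  pose h : {poly rat} -> algC := horner_eval z \o map_poly ratr.
  have -> : root (map_poly ratr (P - ('X^d - 1))`_i) z =
      ((map_poly h (P - ('X^d - 1)))`_i == 0) by rewrite coef_map.
  rewrite rmorphB rmorphB /= rmorph1 /= map_polyXn rmorph_prod /=.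
  have -> : \prod_(m <= k < m + d) map_poly h ('X - ('X^k)%:P) =
      \prod_(m <= k < m + d) ('X - (z ^+ k)%:P).
    apply: eq_bigr => k _; rewrite rmorphB /= map_polyX map_polyC /=.
    by rewrite /h /= /horner_eval map_polyXn hornerXn.
  suff -> : \prod_(m <= k < m + d) ('X - (z ^+ k)%:P) = 'X^d - 1.
    by rewrite subrr coef0.
  (* Shifting the window by one trades the factor at m for the one at m + d; they agree because z^d
     = 1. *)
  elim: m {P} => [|m IH]; first exact: factor_Xn_sub_1.
  rewrite -IH addSn (big_nat_recr (m + d)) /=; last lia.
  rewrite [RHS]big_ltn; last lia.
  by rewrite mulrC exprD (prim_expr_order pz) mulr1.
(* The witness divides the difference by [PhiQ d] coefficient by coefficient; [dvdC] makes each
   division exact. *)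
exists (\poly_(i < size (P - ('X^d - 1))) ((P - ('X^d - 1))`_i %/ PhiQ d)).
apply/eqP; rewrite -subr_eq0 opprD addrA subr_eq0; apply/eqP/polyP => i.
rewrite coefCM coef_poly; case: ltnP => [_|/(nth_default 0) -> //].
  by rewrite mulrC divpK.
by rewrite mulr0.
Qed.

(** * The common polynomial core of the braiding coefficients *)

(* With x = q^2 and Y = s^2, both R_coef and Rinv_coef are units of A times a
   value of this polynomial. *)
Definition core_poly (m n : nat) : {poly {poly rat}} :=
  (gauss n m)%:P * \prod_(m <= k < m + n) ('X - ('X^k)%:P).

Lemma core_poly_I N m n : (m < N)%N -> (n < N)%N -> (N <= m + n)%N ->
  exists C, core_poly m n = C * ((PhiQ N)%:P * ('X - ('X^(N.-1))%:P)).
Proof.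
move=> mN nN Nmn.
have /dvdpP[c ec] : PhiQ N %| gauss n m.
  by apply: (@PhiQ_dvd_gauss _ _ _ N) => //; rewrite mN addnC.
rewrite /core_poly ec (big_rem N.-1) /=; last by rewrite mem_index_iota; lia.
by set P := \prod_(_ <- _) _; exists (c%:P * P); rewrite polyCM; ring.
Qed.

Lemma core_poly_J N d m n : (0 < d)%N -> (d %| N)%N -> (m < N)%N ->
    (N <= m + n)%N ->
  exists C D, core_poly m n = C * (PhiQ d)%:P + D * ('X^d - 1).
Proof.
move=> d0 dN mN Nmn; have [nd|dn] := ltnP n d.
  have /dvdpP[c ec] : PhiQ d %| gauss n m.
    by apply: (@PhiQ_dvd_gauss _ _ _ N) => //; rewrite mN addnC.
  rewrite /core_poly ec polyCM mulrAC.
  by eexists; exists 0; rewrite mul0r addr0.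
have [C eC] := prod_consecutive m d0.
(* The first d factors are reduced modulo [PhiQ d]; the binomial and the remaining factors go into
   the cofactors. *)
rewrite /core_poly (@big_cat_nat _ _ _ (m + d)) ?leq_addr ?leq_add2l //= eC.
set G := _%:P; set P := \prod_(_ <= _ < _) _.
by exists (G * C * P), (G * P); ring.
Qed.

(** * Evaluation of polynomials at x = q^2, Y = s^2 in L *)

Lemma constF_laurent c : constF c \in laurent 2.
Proof.
by have := laurent_monomial 2 c 0 0; rewrite !expr0z !mulr1.
Qed.

Definition constL (c : rat) : ringL := LaurentPoly (constF_laurent c).

Lemma constL_is_zmod_morphism : zmod_morphism constL.
Proof.
by move=> a b; apply: val_inj; rewrite /= /constF !polyCB tofracB.
Qed.

Lemma constL_is_monoid_morphism : monoid_morphism constL.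
Proof.
split; first by apply: val_inj; rewrite /= /constF !polyC1 tofrac1.
by move=> a b; apply: val_inj; rewrite /= /constF !polyCM tofracM.
Qed.

HB.instance Definition _ :=
  GRing.isZmodMorphism.Build rat ringL constL constL_is_zmod_morphism.
HB.instance Definition _ :=
  GRing.isMonoidMorphism.Build rat ringL constL constL_is_monoid_morphism.

Definition q2L : ringL := LaurentPoly (laurent_qz 2 1).
Definition s2L : ringL := LaurentPoly (laurent_sz 2 1).

Definition evq : {poly rat} -> ringL :=
  horner_morph (fun c => mulrC q2L (constL c)).
HB.instance Definition _ := GRing.RMorphism.on evq.

Definition evL : {poly {poly rat}} -> ringL :=
  horner_morph (fun c => mulrC s2L (evq c)).
HB.instance Definition _ := GRing.RMorphism.on evL.

Lemma evLC p : evL p%:P = evq p. Proof. exact: horner_morphC. Qed.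
Lemma evLX : evL 'X = s2L. Proof. exact: horner_morphX. Qed.
Lemma evqX : evq 'X = q2L. Proof. exact: horner_morphX. Qed.

Lemma evq_PhiQ d : evq (PhiQ d) = phi_q2 d.
Proof.
apply: val_inj; rewrite /= /evq /horner_morph /PhiQ -map_poly_comp.
rewrite -[LHS]/(val _) -horner_map -map_poly_comp /= /phi_q2F expr1z.
congr (_.[_]); apply: eq_map_poly => z /=.
by rewrite -[LHS]/(val (constL z%:~R)) !rmorph_int.
Qed.

(** * Spanned ideals and products of comaximal ideals *)

Section IdealSpan.
Variable T : comNzRingType.
Implicit Types (X I J : set T) (x y a : T).

Lemma ideal_span_gen X x : X x -> ideal_span X x.
Proof.
move=> Xx; exists [:: (1, x)]; split; last by rewrite big_seq1 mul1r.
by move=> u; rewrite inE => /eqP ->.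
Qed.

Lemma ideal_spanM X a x : ideal_span X x -> ideal_span X (a * x).
Proof.
by move=> hx; rewrite -[_ * _]addr0; apply: ideal_spanDM hx (ideal_span0 X).
Qed.

Lemma ideal_spanD X x y :
  ideal_span X x -> ideal_span X y -> ideal_span X (x + y).
Proof. by move=> hx hy; rewrite -[x]mul1r; apply: ideal_spanDM. Qed.

Lemma ideal_mulM I J x y : I x -> J y -> ideal_mul I J (x * y).
Proof. by move=> Ix Jy; apply: ideal_span_gen; exists x => //; exists y. Qed.

(** The product of the chosen elements serves as b, since 1 - ab = a(1 - b) + (1 - a). *)
Lemma prod_comaximal1 (K : eqType) (r : seq K) (J : K -> set T) X :
  (forall d, d \in r -> exists2 a, J d a & ideal_span X (1 - a)) ->
  exists2 b, (\big[@ideal_mul T / setT]_(d <- r) J d) b & ideal_span X (1 - b).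
Proof.
elim: r => [|d r IH] h.
  by exists 1; rewrite ?big_nil // subrr; exact: ideal_span0.
have [e er|b hb Xb] := IH; first by apply: h; rewrite inE er orbT.
have [a Ja Xa] := h d (mem_head _ _).
exists (a * b); first by rewrite big_cons; apply: ideal_mulM.
by rewrite (_ : 1 - a * b = a * (1 - b) + (1 - a)); [exact: ideal_spanDM|ring].
Qed.

(** Take b in the product of the remaining ideals with 1 - b in the first one. In x = (1 - b)x + xb
    each summand is then a product of an element of the first ideal and one of the product of the
    others. *)
Lemma prod_comaximal (K : eqType) (r : seq K) (X : K -> set T) x :
  uniq r ->
  {in r &, forall d e, d != e -> exists2 a,
     ideal_span (X e) a & ideal_span (X d) (1 - a)} ->
  {in r, forall d, ideal_span (X d) x} ->
  (\big[@ideal_mul T / setT]_(d <- r) ideal_span (X d)) x.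
Proof.
elim: r => [|d r IH] /=; first by rewrite big_nil.
case/andP=> dr ur com hx; rewrite big_cons.
have [e er|b hb Xb] := @prod_comaximal1 _ r (fun e => ideal_span (X e)) (X d).
  apply: com; rewrite ?mem_head ?inE ?er ?orbT //.
  by apply: contraNneq dr => ->.
rewrite (_ : x = (1 - b) * x + x * b); last by ring.
apply: ideal_spanD; apply: ideal_mulM => //; last first.
  by apply: hx; rewrite mem_head.
apply: IH => // [e f er fr|e er]; last by apply: hx; rewrite inE er orbT.
by apply: com; rewrite inE ?er ?fr orbT.
Qed.

End IdealSpan.

(** * The core element lies in the ideals of L *)

Lemma s2L_expB1 d : s2L ^+ d - 1 = (s2L - 1) * s_quot d.
Proof.
apply: val_inj; rewrite rmorphM !rmorphB rmorph1 rmorphXn /= /s_quotF expr1z.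
by rewrite mulrC divfK ?sF2_neq1 // exprM.
Qed.

(** With w = q^(-2(N-1)) a unit, the generator is associate to phi_N(q^2) (s^2 - q^(2(N-1))), the
    form found in [core_poly_I]. *)
Lemma I_gen_s2L N : (0 < N)%N -> exists2 w : ringL, w * q2L ^+ N.-1 = 1 &
  I_gen N = phi_q2 N * (s2L * w - 1).
Proof.
move=> N0; have qn0 : qF ^+ 2 != 0 by rewrite expf_neq0 ?qF_neq0.
exists (LaurentPoly (laurent_qz 2 (- N.-1%:Z))); apply: val_inj.
  by rewrite rmorphM rmorphXn /= expr1z -exprnN (mulVf (expf_neq0 _ qn0)).
rewrite rmorphM rmorphB rmorphM /= /I_genF expr1z; congr (_ * (_ * _ - _)).
rewrite exprnP exprz_exp; congr (_ ^ _); lia.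
Qed.

Lemma core_in_ideal_I N m n : (m < N)%N -> (n < N)%N -> (N <= m + n)%N ->
  ideal_I N (evL (core_poly m n)).
Proof.
move=> mN nN Nmn; have [C ->] := core_poly_I mN nN Nmn.
rewrite !rmorphM rmorphB /= !evLC evLX rmorphXn evq_PhiQ /= evqX.
have [|w wq eI] := @I_gen_s2L N; first by exact: leq_ltn_trans mN.
rewrite (_ : _ * (_ * _) = evL C * q2L ^+ N.-1 * I_gen N).
  exact/ideal_spanM/ideal_span_gen.
rewrite eI; set Q := q2L ^+ N.-1 in wq *.
transitivity (evL C * (phi_q2 N * (s2L * (w * Q) - Q))); last by ring.
by rewrite wq mulr1.
Qed.

Lemma core_in_ideal_J N d m n : (0 < d)%N -> (d %| N)%N -> (m < N)%N ->
  (N <= m + n)%N -> ideal_J d (evL (core_poly m n)).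
Proof.
move=> d0 dN mN Nmn; have [C [D ->]] := core_poly_J d0 dN mN Nmn.
rewrite rmorphD !rmorphM rmorphB rmorph1 rmorphXn /= !evLC evLX evq_PhiQ.
apply: ideal_spanDM; first by apply: ideal_span_gen; left.
(* s^(2d) - 1 is a multiple of the second generator, with cofactor s^2 - 1. *)
by rewrite s2L_expB1 mulrA; apply/ideal_spanM/ideal_span_gen; right.
Qed.

(** A Bezout relation between [PhiQ d] and [PhiQ e], evaluated at q^2, writes 1 as a sum of elements
    of the two ideals. *)
Lemma ideal_J_comaximal d e : (0 < d)%N -> (0 < e)%N -> d != e ->
  exists2 a, ideal_J e a & ideal_J d (1 - a).
Proof.
move=> d0 e0 de; have /Bezout_eq1_coprimepP[[u v] /= uv] :=
  coprimep_PhiQ_PhiQ d0 e0 de.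
exists (evq v * phi_q2 e); first by apply/ideal_spanM/ideal_span_gen; left.
have -> : 1 - evq v * phi_q2 e = evq u * phi_q2 d.
  by rewrite -!evq_PhiQ -(rmorph1 evq) -uv rmorphD !rmorphM /= addrK.
by apply/ideal_spanM/ideal_span_gen; left.
Qed.

Lemma core_in_ideal v N m n : (m < N)%N -> (n < N)%N -> (N <= m + n)%N ->
  ideal_of v N (evL (core_poly m n)).
Proof.
move=> mN nN Nmn; case: v => /=; first exact: core_in_ideal_I.
split; first exact: core_in_ideal_I.
have N0 : (0 < N)%N by exact: leq_ltn_trans mN.
have hr d : d \in [seq d <- divisors N | (d != 1%N) && (d != N)] ->
    (0 < d)%N /\ (d %| N)%N.
  rewrite mem_filter -dvdn_divisors // => /andP[_ dN].
  by split=> //; exact: dvdn_gt0 dN.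
rewrite -big_filter; apply: prod_comaximal.
- by rewrite filter_uniq ?divisors_uniq.
- by move=> d e /hr[d0 _] /hr[e0 _]; exact: ideal_J_comaximal.
- by move=> d /hr[d0 dN]; exact: core_in_ideal_J dN mN Nmn.
Qed.

(** * Braiding coefficients as multiples of the core element in A *)

Lemma mulf_shift (F : fieldType) (x y z : F) :
  x != 0 -> x * (y * z) = y * x^-1 * (x * x * z).
Proof. by move=> x0; field. Qed.

Lemma factor_shift (F : fieldType) (x y : F) : x != 0 -> y != 0 ->
  x * y^-1 - x^-1 * y = x^-1 * y^-1 * (x ^+ 2 - y ^+ 2).
Proof. by move=> x0 y0; field; rewrite x0 y0. Qed.

(** The Pascal rules match: [gaussSS] at x = q^2, multiplied by q^(-(a+1)(b+1)), becomes
    [qbinomS]. *)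
Lemma qbinom_gauss a b :
  qbinom (a + b) b = qF ^- (a * b) * val (evq (gauss a b)).
Proof.
elim: a b => [|a IHa] b.
  by rewrite add0n qbinomnn gauss0n rmorph1 mul0n expr0 invr1 mul1r.
elim: b => [|b IHb].
  by rewrite addn0 qbinom0 gaussn0 rmorph1 muln0 expr0 invr1 mul1r.
rewrite qbinomS IHa IHb gaussSS rmorphD rmorphM rmorphXn /= evqX.
have -> : laurent_val (q2L ^+ b.+1) = qF ^+ b.+1 * qF ^+ b.+1.
  rewrite -[LHS]/(val _) rmorphXn /= expr1z -exprM -exprD; congr (_ ^+ _); lia.
have -> : (a.+1 * b.+1 = a * b.+1 + b.+1)%N by rewrite mulSn addnC.
rewrite mulrDr; congr (_ + _).
  rewrite exprD invfM; have := expf_neq0 b.+1 qF_neq0.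
  exact: mulf_shift.
rewrite mulrA; congr (_ * _); rewrite -invfM -exprD; congr (_ ^- _).
by rewrite mulSn; lia.
Qed.

Lemma val_evL_core m n : val (evL (core_poly m n)) =
  val (evq (gauss n m)) * \prod_(k < n) (sF ^+ 2 - qF ^+ (2 * (k + m))).
Proof.
have -> : evL (core_poly m n) =
    evq (gauss n m) * \prod_(k < n) (s2L - q2L ^+ (k + m)).
  rewrite /core_poly rmorphM /= evLC; congr (_ * _).
  rewrite -{1}[m]add0n big_addn addKn big_mkord rmorph_prod.
  by apply: eq_bigr => k _; rewrite rmorphB /= evLC evLX rmorphXn /= evqX.
rewrite rmorphM rmorph_prod; congr (_ * _); apply: eq_bigr => k _.
by rewrite rmorphB rmorphXn /= !expr1z exprM.
Qed.

Lemma prod_core j n :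
  \prod_(k < n) (sF * qF ^- (k + j) - sF^-1 * qF ^+ (k + j)) =
  \prod_(k < n) (sF^-1 * qF ^- (k + j)) *
  \prod_(k < n) (sF ^+ 2 - qF ^+ (2 * (k + j))).
Proof.
rewrite -big_split /=; apply: eq_bigr => k _.
by rewrite mulnC exprM; rewrite (factor_shift sF_neq0 (expf_neq0 _ qF_neq0)).
Qed.

Lemma core_in_quot v N m n (u : ratfun) (x : ringA) : u \in laurent 1 ->
  val x = u * val (evL (core_poly m n)) ->
  (m < N)%N -> (n < N)%N -> (N <= m + n)%N -> x \in quot_ideal v N.
Proof.
move=> uL ex mN nN Nmn; apply/asboolP.
rewrite (_ : x = LaurentPoly uL * LtoA (evL (core_poly m n))).
  apply/ideal_spanM/ideal_span_gen.
  by exists (evL (core_poly m n)) => //; exact: core_in_ideal.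
by apply: val_inj; rewrite ex.
Qed.

Lemma prod_unit_laurent n j :
  \prod_(k < n) (sF^-1 * qF ^- (k + j)) \in laurent 1.
Proof.
apply: rpred_prod => k _; apply: rpredM; first exact: (laurent1_sV 1).
exact: laurent1_qV.
Qed.

Lemma R_coef_in_quot v N i j n : (j < N)%N -> (n < N)%N -> (N <= j + n)%N ->
  R_coef i j n \in quot_ideal v N.
Proof.
move=> jN nN Njn; apply: core_in_quot jN nN Njn; last first.
  rewrite [val _]/= /R_coefF qbinom_gauss prod_core val_evL_core.
  set U := \prod_(_ < _) (_ * _); set P := \prod_(_ < _) _.
  set G := val _; set a := sF ^- _; set b := qF ^+ _; set c := qF ^+ _.
  set d := qF ^- _.
  (* Collecting the core as the last factor lets unification read off the multiplier u, whose
     membership in A is checked next. *)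
  by rewrite (_ : _ * _ = a * b * c * d * U * (G * P)) //; ring.
rewrite !rpredM ?prod_unit_laurent ?laurent1_q ?laurent1_qV //.
exact: laurent1_sV.
Qed.

Lemma Rinv_coef_in_quot v N i j n : (i < N)%N -> (n < N)%N -> (N <= i + n)%N ->
  Rinv_coef i j n \in quot_ideal v N.
Proof.
move=> iN nN Nin; apply: core_in_quot iN nN Nin; last first.
  rewrite [val _]/= /Rinv_coefF qbinom_gauss.
  under eq_bigr => k _ do rewrite addnC.
  rewrite prod_core val_evL_core.
  set U := \prod_(_ < _) (_ * _); set P := \prod_(_ < _) _.
  set G := val _; set a := sF ^+ _; set e := (-1) ^+ _; set b := qF ^- _.
  set c := qF ^- _; set d := qF ^- _.
  by rewrite (_ : _ * _ = a * e * b * c * d * U * (G * P)) //; ring.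
rewrite !rpredM ?prod_unit_laurent ?laurent1_qV ?laurent1_s //.
by rewrite rpredX // rpredN rpred1.
Qed.

(** * Linear extension from a basis of a free module *)

Section Linext.
Variables (S : nzRingType) (K K' : choiceType).
Implicit Types (f : K -> {malg S[K']}) (x : {malg S[K]}).

(** Enlarging the index set lets elements with different supports be summed over a common one, as
    linearity requires. *)
Lemma linextEw (d : {fset K}) f x : (msupp x `<=` d)%fset ->
  linext f x = \sum_(k <- d) x@_k *: f k.
Proof.
move=> le; rewrite [LHS](big_fset_incl _ le) => //= k kd /mcoeff_outdom ->.
by rewrite scale0r.
Qed.

Lemma linextU f c k : linext f << c *g k >> = c *: f k.
Proof. by rewrite (linextEw f msuppU_le) big_seq_fset1 mcoeffUU. Qed.

Lemma linext_is_linear f : linear (linext f).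
Proof.
move=> a x y; pose d := (msupp x `|` msupp y)%fset.
rewrite !(@linextEw d) ?fsubsetUl ?fsubsetUr //; last first.
  apply: fsubset_trans (msuppD_le _ _) _.
  by apply: fsetUSS; rewrite ?msuppZ_le ?fsubset_refl.
rewrite scaler_sumr -big_split; apply: eq_bigr => k _ /=.
by rewrite mcoeffD mcoeffZ scalerDl scalerA.
Qed.

HB.instance Definition _ f :=
  GRing.isLinear.Build S {malg S[K]} {malg S[K']} *:%R (linext f)
    (linext_is_linear f).

Lemma malgZU (a c : S) (k : K) : a *: << c *g k >> = << a * c *g k >>.
Proof. by apply/malgP => l; rewrite mcoeffZ !mcoeffU mulrnAr. Qed.

Lemma malg_basis x : x = \sum_(k <- msupp x) x@_k *: << k >>.
Proof.
by rewrite {1}[x]monalgE; apply: eq_bigr => k _; rewrite malgZU mulr1.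
Qed.

Lemma linear_ext_malg (F G : {linear {malg S[K]} -> {malg S[K']}}) :
  (forall k, F << k >> = G << k >>) -> F =1 G.
Proof.
move=> FG x; rewrite [x]malg_basis !linear_sum; apply: eq_bigr => k _.
by rewrite !linearZ /= FG.
Qed.

End Linext.

(** * Base change from A to S and functoriality of specialisation *)

Section Specialize.
Variables (v : variant) (N : nat).
Local Notation S := (quotS v N).
Local Notation pi := (piS v N).

Lemma piS_is_zmod_morphism : zmod_morphism pi.
Proof. by move=> a b; rewrite /piS rmorphB. Qed.

Lemma piS_is_monoid_morphism : monoid_morphism pi.
Proof. by split=> [|a b]; rewrite /piS ?rmorph1 ?rmorphM. Qed.

HB.instance Definition _ :=
  GRing.isZmodMorphism.Build ringA S pi piS_is_zmod_morphism.
HB.instance Definition _ :=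
  GRing.isMonoidMorphism.Build ringA S pi piS_is_monoid_morphism.

Lemma piS_eq0 a : a \in quot_ideal v N -> pi a = 0.
Proof.
move=> ha; rewrite -[RHS](rmorph0 pi); apply/eqP.
by rewrite -Quotient.idealrBE subr0.
Qed.

Section Base.
Variable K : choiceType.
Implicit Types (x : {malg ringA[K]}).

(** The base change map sending x to x (x) 1. *)
Definition map_piS x : {malg S[K]} := \sum_(l <- msupp x) << pi x@_l *g l >>.

Lemma mcoeff_map_piS x k : (map_piS x)@_k = pi x@_k.
Proof.
rewrite {2}[x]monalgE !raddf_sum /=; apply: eq_bigr => l _.
by rewrite !mcoeffU rmorphMn.
Qed.

Lemma map_piSZD a x y : map_piS (a *: x + y) = pi a *: map_piS x + map_piS y.
Proof.
apply/malgP => k.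
by rewrite !(mcoeffD, mcoeffZ, mcoeff_map_piS) rmorphD rmorphM.
Qed.

Lemma map_piSU k : map_piS << k >> = << k >>.
Proof.
by apply/malgP => l; rewrite mcoeff_map_piS !mcoeffU rmorphMn rmorph1.
Qed.

Lemma map_piS0 : map_piS 0 = 0.
Proof. by rewrite /map_piS msupp0 big_seq_fset0. Qed.

Implicit Types F G : {malg ringA[K]} -> {malg ringA[K]}.

Lemma specialize_is_linear F : linear (@specialize v N K F).
Proof. exact: linext_is_linear. Qed.

HB.instance Definition _ F :=
  GRing.isLinear.Build S {malg S[K]} {malg S[K]} *:%R (@specialize v N K F)
    (specialize_is_linear F).

Lemma specializeU F k : @specialize v N K F << k >> = map_piS (F << k >>).
Proof. by rewrite /specialize linextU scale1r. Qed.

(** Naturality of base change: both sides are semilinear over [piS] and agree on basis vectors.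
    Functoriality of [specialize] rests on it. *)
Lemma specialize_map_piS F x : linear F ->
  specialize F (map_piS x) = map_piS (F x).
Proof.
move=> lF; have F0 : F 0 = 0.
  by apply: (addIr (F 0)); rewrite -{1}[F 0]scale1r -lF scale1r !add0r.
rewrite {1 2}[x]malg_basis.
elim: (enum_fset (msupp x)) => [|k s IH].
  by rewrite !big_nil F0 map_piS0 linear0.
rewrite !big_cons map_piSZD lF specialize_is_linear map_piSZD IH.
by rewrite map_piSU specializeU.
Qed.

Lemma eq_specialize F G : F =1 G -> @specialize v N K F =1 @specialize v N K G.
Proof.
by move=> FG x; apply: eq_bigr => k _; rewrite FG.
Qed.

Lemma specialize_comp F G (x : {malg S[K]}) : linear F ->
  specialize (F \o G) x = @specialize v N K F (specialize G x).
Proof.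
move=> lF; apply: (linear_ext_malg (F := specialize (F \o G))
  (G := specialize F \o specialize G)) => k /=.
by rewrite !specializeU specialize_map_piS.
Qed.

Lemma specialize_id (x : {malg S[K]}) : @specialize v N K id x = x.
Proof.
apply: (linear_ext_malg (F := specialize id) (G := idfun)) => k /=.
by rewrite specializeU map_piSU.
Qed.

End Base.
End Specialize.

(** * Stability of the truncated tensor powers *)

Section Truncation.
Variables (N : nat) (N0 : (0 < N)%N) (n : nat).

Definition small (t : n.-tuple nat) : bool := all (fun k => k < N)%N t.

Lemma truncatedU (S : nzRingType) (c : S) (t : n.-tuple nat) :
  small t -> << c *g t >> \in @truncated S N n.
Proof.
(* The default value [Ordinal N0] is never taken, since all entries of t are below N. *)
move=> st; pose t' : n.-tuple 'I_N := map_tuple (insubd (Ordinal N0)) t.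
have et : map_tuple val t' = t.
  apply: val_inj; rewrite /= -map_comp map_id_in // => k kt /=.
  by rewrite insubdK //; exact: (allP st).
apply/asboolP; exists (fun u => if u == t' then c else 0).
rewrite (bigD1 t') //= eqxx et malgZU mulr1 big1 ?addr0 // => u /negPf ->.
by rewrite scale0r.
Qed.

Variable v : variant.
Local Notation S := (quotS v N).

Lemma map_piS_truncated (x : verma_pow ringA n) :
  (forall t, ~~ small t -> x@_t \in quot_ideal v N) ->
  map_piS v N x \in @truncated S N n.
Proof.
move=> hx; apply: rpred_sum => t _; have [st|nt] := boolP (small t).
  exact: truncatedU.
by rewrite piS_eq0 ?hx // monalgU0 rpred0.
Qed.

Definition stable (F : verma_pow ringA n -> verma_pow ringA n) : Prop :=
  forall x : verma_pow S n, x \in @truncated S N n ->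
  specialize F x \in @truncated S N n.

Lemma stable_basis F :
  (forall t u, small t -> ~~ small u -> (F << t >>)@_u \in quot_ideal v N) ->
  stable F.
Proof.
move=> hF _ /asboolP[c ->]; rewrite linear_sum; apply: rpred_sum => t _ /=.
rewrite linearZ /= rpredZ // specializeU map_piS_truncated // => u.
by apply: hF; apply/allP => _ /mapP[k _ ->] /=.
Qed.

(** The shape shared by R and its inverse: on a basis vector, term k has coefficient c and target
    index p. Each term either stays in the truncation or has a coefficient that vanishes in S. *)
Lemma stable_on_strands (i : nat) (F : verma_sq ringA -> verma_sq ringA)
    (m : nat -> nat -> nat) (c : nat -> nat -> nat -> ringA)
    (p : nat -> nat -> nat -> nat * nat) :
  (i.+1 < n)%N ->
  (forall a b, F << (a, b) >> = \sum_(k < m a b) << c a b k *g p a b k >>) ->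
  (forall a b k, (a < N)%N -> (b < N)%N -> (k < m a b)%N ->
     (p a b k).1 < N /\ (p a b k).2 < N \/ c a b k \in quot_ideal v N)%N ->
  stable (@on_strands ringA n i F).
Proof.
move=> iN eF hc; apply: stable_basis => t u st nu.
have nthN j : (j < n)%N -> (nth 0%N t j < N)%N.
  by move=> jn; apply: (all_nthP 0%N st); rewrite size_tuple.
rewrite /on_strands linextU scale1r eF linear_sum raddf_sum.
apply: rpred_sum => k _ /=; rewrite linextU mcoeffZ mcoeffU mulrnAr mulr1.
set a := nth 0%N t i; set b := nth 0%N t i.+1.
have [[p1 p2]|ck] :=
  hc a b k (nthN _ (ltnW iN)) (nthN _ iN) (ltn_ord k); last exact: rpredMn.
(* If u is the target of this term, its two new entries and the untouched ones are all below N,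
   contradicting [nu]. *)
case: eqP => [eu|_]; last by rewrite mulr0n rpred0.
case/negP: nu; rewrite -eu; apply/all_tnthP => j; rewrite tnth_mktuple.
by case: ifP => // _; case: ifP => // _; exact: (all_tnthP st).
Qed.

Lemma stable_R (i : 'I_n.-1) : stable (@on_strands ringA n i R_op).
Proof.
apply: (@stable_on_strands _ _ (fun a _ => a.+1) R_coef
  (fun a b k => (b + k, a - k)%N)).
- by have := ltn_ord i; lia.
- by move=> a b; rewrite /R_op linextU scale1r.
move=> a b k aN bN ka /=; have [bk|bk] := ltnP (b + k) N.
  by left; split=> //; lia.
(* The bound k <= a < N gives the condition n < N on the summation index. *)
by right; apply: R_coef_in_quot => //; lia.
Qed.

Lemma stable_Rinv (i : 'I_n.-1) : stable (@on_strands ringA n i Rinv_op).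
Proof.
apply: (@stable_on_strands _ _ (fun _ b => b.+1) Rinv_coef
  (fun a b k => (b - k, a + k)%N)).
- by have := ltn_ord i; lia.
- by move=> a b; rewrite /Rinv_op linextU scale1r.
move=> a b k aN bN kb /=; have [ak|ak] := ltnP (a + k) N.
  by left; split=> //; lia.
by right; apply: Rinv_coef_in_quot => //; lia.
Qed.

Lemma eq_stable F G : F =1 G -> stable F -> stable G.
Proof. by move=> FG sF x hx; rewrite -(eq_specialize FG) sF. Qed.

(** Induction on a representing word, letter by letter; the letter [(false, i)] is identified with
    the group inverse of [sigma i]. *)
Lemma braid_ind (P : braid n -> Prop) :
  P 1%g ->
  (forall i b, P b -> P (sigma i * b)%g) ->
  (forall i b, P b -> P ((sigma i)^-1 * b)%g) ->
  forall b, P b.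
Proof.
move=> P1 Ps Pi b; rewrite -[b]braid_reprK.
elim: (repr b) => [//|[e i] w IH].
rewrite -cat1s -braid_pi_cat; case: e; first exact: Ps.
have e1 : (braid_pi [:: (false, i)] * sigma i)%g = 1%g.
  by rewrite [LHS]braid_pi_cat; apply/braid_piP/(braid_eq_inv false i).
by rewrite -[braid_pi [:: _]](mulgK (sigma i)) e1 mul1g; exact: Pi.
Qed.

(** * The induced representation on the truncation *)

Variable rho_hat : {multiplicative braid n -> linaut (verma_pow ringA n)}.

Lemma specialize_rhoM b b' (x : verma_pow S n) :
  specialize (rho_hat (b * b')%g) x =
  specialize (rho_hat b) (specialize (rho_hat b') x).
Proof.
by rewrite gmulfM -specialize_comp //; exact: linaut_linear.
Qed.

(** A multiplicative map records products only, so its value at 1 is obtained by cancellation. *)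
Lemma rho_hat1 : rho_hat 1%g = 1%g.
Proof.
by apply: (mulgI (rho_hat 1%g)); rewrite -gmulfM !mulg1.
Qed.

Lemma specialize_rho1 (x : verma_pow S n) : specialize (rho_hat 1%g) x = x.
Proof. by rewrite rho_hat1 specialize_id. Qed.

Hypothesis Hrho : is_generic_braid_action rho_hat.

Lemma stable_rho b : stable (rho_hat b).
Proof.
elim/braid_ind: b => [x|i b IH x hx|i b IH x hx].
- by rewrite specialize_rho1.
- rewrite specialize_rhoM; apply: (eq_stable (fsym (Hrho i).1) (stable_R i)).
  exact: IH.
rewrite specialize_rhoM.
by apply: (eq_stable (fsym (Hrho i).2) (stable_Rinv i)); exact: IH.
Qed.

Definition rho_trunc_fun b (x : trunc_pow S N n) : trunc_pow S N n :=
  TruncPow (stable_rho b (valP x)).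

Lemma rho_trunc_linear b : linear (rho_trunc_fun b).
Proof. by move=> a x y; apply: val_inj; rewrite /= !linearP. Qed.

(** The inverse on the truncation is the action of [b^-1]; stability under b alone would only give
    an injective map. *)
Lemma rho_trunc_funK b : cancel (rho_trunc_fun b) (rho_trunc_fun b^-1%g).
Proof.
by move=> x; apply: val_inj; rewrite /= -specialize_rhoM mulVg specialize_rho1.
Qed.

Lemma rho_trunc_invK b : cancel (rho_trunc_fun b^-1%g) (rho_trunc_fun b).
Proof. by move=> x; have := rho_trunc_funK b^-1%g x; rewrite invgK. Qed.

Definition rho_trunc b : linaut (trunc_pow S N n) :=
  LinAut (@rho_trunc_linear b) (@rho_trunc_funK b) (@rho_trunc_invK b).

Lemma rho_truncM : {morph rho_trunc : b b' / (b * b')%g}.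
Proof.
move=> b b'; apply: linautP => x; apply: val_inj.
by rewrite /= specialize_rhoM.
Qed.

HB.instance Definition _ := monoid.isMultiplicative.Build (braid n)
  (linaut (trunc_pow S N n)) rho_trunc rho_truncM.

End Truncation.

Theorem theorem1p4 (N : nat) (HN : (2 <= N)%N) (v : variant)
    (n : nat) (Hn : (1 <= n)%N)
    (rho_hat : {multiplicative braid n -> linaut (verma_pow ringA n)})
    (Hrho : is_generic_braid_action rho_hat) :
  (forall (b : braid n) (x : verma_pow (quotS v N) n),
     x \in @truncated (quotS v N) N n ->
     specialize (rho_hat b) x \in @truncated (quotS v N) N n) /\
  exists rho : {multiplicative braid n -> linaut (trunc_pow (quotS v N) N n)},
    forall (b : braid n) (x : trunc_pow (quotS v N) N n),
      trunc_val (rho b x) = specialize (rho_hat b) (trunc_val x).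
Proof.
have N0 : (0 < N)%N := ltnW HN.
by split; [exact: stable_rho | exists (rho_trunc N0 v Hrho)].
Qed.
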